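(* Let $(G,\mathbf{c},p)$ be an angle framework with $G=(V,E)$, $|V|\ge 2$, and color set $C=\mathbf{c}(E)$. Then $(G,\mathbf{c},p)$ is infinitesimally angle-rigid if and only if $\operatorname{rank} R(G,\mathbf{c},p)=2|V|+|C|-4$.
   Context: Graphs are finite and simple. A realization of $G=(V,E)$ is an injective map $p:V\to\mathbb{R}^2$. An edge-colored graph $(G,\mathbf{c})$ is a graph $G$ with a map $\mathbf{c}$ assigning a color to every edge; $C=\mathbf{c}(E)$ is the set of colors used. An angle framework is a triple $(G,\mathbf{c},p)$ with $(G,\mathbf{c})$ an edge-colored graph and $p$ a realization of $G$. Write $P_{vw}=p_v-p_w$, and let $x^\perp$ denote the counter-clockwise rotation of $x\in\mathbb{R}^2$ by $90^\circ$. The angle-rigidity matrix is the $|E|\times(2|V|+|C|)$ matrix $R(G,\mathbf{c},p)=[\,R(G,p)\;\; M(G,\mathbf{c},p)\,]$. Here $R(G,p)$ is the standard 2-dimensional rigidity matrix (the row of edge $vw$ has $P_{vw}$ in the two columns of $v$, $-P_{vw}$ in the two columns of $w$, and zeros elsewhere), and $M(G,\mathbf{c},p)$ is the $|E|\times|C|$ matrix whose entry in row $vw$ and column $c$ is $-P_{vw}\cdot P_{vw}$ if $\mathbf{c}(vw)=c$ and $0$ otherwise. A map $u:V\to\mathbb{R}^2$ is an infinitesimal flex of $(G,\mathbf{c},p)$ if for all edges $ab,vw\in E$ with $\mathbf{c}(ab)=\mathbf{c}(vw)$, $$\frac{P_{ab}^\perp}{P_{ab}\cdot P_{ab}}\cdot(u_a-u_b)-\frac{P_{vw}^\perp}{P_{vw}\cdot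 P_{vw}}\cdot(u_v-u_w)=0 .$$ An infinitesimal flex is trivial if it is the restriction to the points $p_v$ of an infinitesimal similarity, i.e. there are $\alpha,\beta\in\mathbb{R}$ and $z\in\mathbb{R}^2$ with $u_v=\alpha p_v+\beta p_v^\perp+z$ for all $v\in V$. The framework $(G,\mathbf{c},p)$ is infinitesimally angle-rigid if every infinitesimal flex is trivial. *)

(* Defs.v *)
From mathcomp Require Import all_boot all_order all_algebra.
From mathcomp Require Import reals.

Set Implicit Arguments.
Unset Strict Implicit.
Unset Printing Implicit Defensive.

Import Order.TTheory GRing.Theory Num.Theory.
Local Open Scope ring_scope.

Record sgraph (V : finType) := SGraph {
  edge_set : {set {set V}};
  edge_set_card : forall f, f \in edge_set -> #|f| = 2%N
}.

Definition edge (V : finType) (G : sgraph V) := {f : {set V} | f \in edge_set G}.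

Lemma edge_card (V : finType) (G : sgraph V) (f : edge G) : #|val f| = 2%N.
Proof. exact: edge_set_card (valP f). Qed.

(* The two endpoints of an edge, in the order in which they are enumerated.
   This order is an arbitrary choice: the rigidity matrices below do not depend
   on it, since exchanging v and w turns P_vw into - P_vw. *)
Definition endpoint (V : finType) (G : sgraph V) (f : edge G) (k : 'I_2) : V :=
  enum_val (cast_ord (esym (edge_card f)) k).

(* The set C = c(E), as a duplicate-free list; its cardinality is its size. *)
Definition colors (V : finType) (G : sgraph V) (K : eqType) (c : edge G -> K) :
  seq K := undup (codom c).

Section Plane.
Variable R : realType.

Definition dot (x y : 'rV[R]_2) : R := \sum_(k < 2) x 0 k * y 0 k.

Definition perp (x : 'rV[R]_2) : 'rV[R]_2 :=
  \row_(k < 2) (if k == 0 then - x 0 1 else x 0 0).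

End Plane.

Section AngleFramework.
Variables (R : realType) (V : finType) (G : sgraph V).
Variables (K : eqType) (c : edge G -> K) (p : V -> 'rV[R]_2).

Definition realization : Prop := injective p.

Definition diffp (v w : V) : 'rV[R]_2 := p v - p w.

Definition edge_vec (f : edge G) : 'rV[R]_2 :=
  diffp (endpoint f 0) (endpoint f 1).

(* The row of an edge is a #|V| x 2 array (the two columns of each vertex),
   flattened by mxvec. *)
Definition rigidity_mx : 'M[R]_(#|{: edge G}|, #|V| * 2) :=
  \matrix_(i < #|{: edge G}|)
    let f := enum_val i in
    mxvec (\matrix_(j < #|V|, k < 2)
      let x := enum_val j in
      if x == endpoint f 0 then edge_vec f 0 k
      else if x == endpoint f 1 then - edge_vec f 0 k
      else 0).

Definition color_mx : 'M[R]_(#|{: edge G}|, size (colors c)) :=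
  \matrix_(i < #|{: edge G}|, j < size (colors c))
    let f := enum_val i in
    if c f == tnth (in_tuple (colors c)) j
    then - dot (edge_vec f) (edge_vec f) else 0.

Definition angle_rigidity_mx :
  'M[R]_(#|{: edge G}|, #|V| * 2 + size (colors c)) :=
  row_mx rigidity_mx color_mx.

Definition edge_rotation (u : V -> 'rV[R]_2) (v w : V) : R :=
  dot ((dot (diffp v w) (diffp v w))^-1 *: perp (diffp v w)) (u v - u w).

Definition infinitesimal_flex (u : V -> 'rV[R]_2) : Prop :=
  forall (f g : edge G) (a b v w : V),
    val f = [set a; b] -> val g = [set v; w] -> c f = c g ->
    edge_rotation u a b - edge_rotation u v w = 0.

Definition trivial_flex (u : V -> 'rV[R]_2) : Prop :=
  exists (alpha beta : R) (z : 'rV[R]_2),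
    forall v, u v = alpha *: p v + beta *: perp (p v) + z.

Definition infinitesimally_angle_rigid : Prop :=
  forall u, infinitesimal_flex u -> trivial_flex u.

End AngleFramework.

(* Main.v *)
Require Import Defs.
From HB Require Import structures.
From mathcomp Require Import all_boot all_order all_algebra.
From mathcomp Require Import reals.
From mathcomp Require Import ring.

(** The rotation u |-> u^perp turns the equations of the angle-rigidity matrix
    into the flex condition. A vector (u, s) is in the right kernel of the
    matrix when P_vw . (u_v - u_w) = s_c |P_vw|^2 for every edge vw of colour c;
    since P . u = P^perp . u^perp, this says that under u^perp every edge of
    colour c rotates at the rate s_c. So a motion u extends to the kernel
    exactly when u^perp is an infinitesimal flex ([perp_flexP]), and s is
    determined by u because each colour is carried by some edge, which has
    positive length as p is injective.

    The infinitesimal similarities u_v = a p_v + b p_v^perp + z, together with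
    s_c = a for every c, form a subspace of this kernel ([similarity_mx_ker]).
    Two distinct points determine a, b and z, so its dimension is 4
    ([similarity_mx_free]). The rotation preserves infinitesimal similarities,
    hence rigidity says that the kernel is contained in this subspace
    ([rigid_kerP]), i.e. that the kernel has dimension 4, and rank-nullity
    concludes. *)

Set Implicit Arguments.
Unset Strict Implicit.
Unset Printing Implicit Defensive.

Import Order.TTheory GRing.Theory Num.Theory.
Local Open Scope ring_scope.

(** * The Euclidean plane *)

Section PlaneLemmas.
Variable R : realType.
Implicit Types (x y z : 'rV[R]_2) (a b : R).

Lemma dotE x y : dot x y = x 0 0 * y 0 0 + x 0 1 * y 0 1.
Proof.
rewrite /dot big_ord_recl big_ord1.
by have -> : lift ord0 ord0 = 1 :> 'I_2 by apply: val_inj.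
Qed.

Lemma row2P x y : x 0 0 = y 0 0 -> x 0 1 = y 0 1 -> x = y.
Proof.
move=> xy0 xy1; apply/rowP => k.
have [j -> | -> //] := unliftP 0 k.
by have -> : lift 0 j = 1 by rewrite (ord1 j); apply: val_inj.
Qed.

Lemma perpK x : perp (perp x) = - x.
Proof. by apply: row2P; rewrite !mxE. Qed.

Lemma perpN x : perp (- x) = - perp x.
Proof. by apply: row2P; rewrite !mxE. Qed.

Lemma perpB x y : perp (x - y) = perp x - perp y.
Proof. by apply: row2P; rewrite !mxE //= opprD opprK. Qed.

Lemma perp_similarity a b x z :
  perp (a *: x + b *: perp x + z) = - b *: x + a *: perp x + perp z.
Proof. by apply: row2P; rewrite !mxE /=; ring. Qed.

Lemma dot_perp x y : dot (perp x) (perp y) = dot x y.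
Proof. by rewrite !dotE !mxE /=; ring. Qed.

Lemma dot_similarity a b x : dot x (a *: x + b *: perp x) = a * dot x x.
Proof. by rewrite !dotE !mxE /=; ring. Qed.

Lemma dotZl a x y : dot (a *: x) y = a * dot x y.
Proof. by rewrite !dotE !mxE; ring. Qed.

Lemma dotNN x y : dot (- x) (- y) = dot x y.
Proof. by rewrite !dotE !mxE; ring. Qed.

Lemma dot_eq0 x : (dot x x == 0) = (x == 0).
Proof.
apply/eqP/eqP => [|->]; last by rewrite dotE !mxE; ring.
rewrite dotE -!expr2 => /eqP.
rewrite paddr_eq0 ?sqr_ge0 // !sqrf_eq0 => /andP[/eqP x0 /eqP x1].
by apply: row2P; rewrite ?x0 ?x1 mxE.
Qed.

(** A nonzero vector and its rotation form an orthogonal basis: the two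
    coefficients are read off by pairing with x and with its rotation. *)
Lemma similarity_eq0 a b x :
  x != 0 -> a *: x + b *: perp x = 0 -> a = 0 /\ b = 0.
Proof.
rewrite -dot_eq0 => x0 e.
have dot0 y : dot y 0 = 0 by rewrite dotE !mxE; ring.
have a0 : a = 0.
  apply/eqP; move: (dot_similarity a b x); rewrite e dot0 => /esym/eqP.
  by rewrite mulf_eq0 (negPf x0) orbF.
split=> //; move: e; rewrite a0 scale0r add0r => /(congr1 (dot (perp x)))/eqP.
have -> : dot (perp x) (b *: perp x) = b * dot x x.
  by rewrite !dotE !mxE /=; ring.
by rewrite dot0 mulf_eq0 (negPf x0) orbF => /eqP.
Qed.

End PlaneLemmas.

(** * The kernel of the angle-rigidity matrix *)

Lemma sum_mxvec (R : comPzRingType) (m n : nat) (A B : 'M[R]_(m, n)) :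
  \sum_k mxvec A 0 k * mxvec B 0 k = \sum_i \sum_j A i j * B i j.
Proof.
rewrite pair_big /= (reindex _ (curry_mxvec_bij _ _)) /=.
by apply: eq_bigr => -[i j] _; rewrite /= !mxvecE.
Qed.

Section Framework.
Variables (R : realType) (V : finType) (G : sgraph V).
Variables (K : eqType) (c : edge G -> K) (p : V -> 'rV[R]_2).
Implicit Types (u : V -> 'rV[R]_2) (f : edge G).

Notation C := (size (colors c)).
Notation color j := (tnth (in_tuple (colors c)) j).

Lemma endpoint_neq f : endpoint f 0 != endpoint f 1.
Proof. by rewrite (inj_eq enum_val_inj) (inj_eq (@cast_ord_inj _ _ _)). Qed.

Lemma edge_endpoints f : val f = [set endpoint f 0; endpoint f 1].
Proof.
apply/esym/eqP; rewrite eqEcard cards2 endpoint_neq edge_card leqnn andbT.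
by apply/subsetP => x; rewrite !inE => /orP[] /eqP ->; apply: enum_valP.
Qed.

Lemma edge_colorP f : exists j, c f = color j.
Proof.
have /seq_tnthP[j ->] : c f \in colors c by rewrite mem_undup codom_f.
by exists j.
Qed.

Lemma color_edgeP (j : 'I_C) : exists f, c f = color j.
Proof.
have : color j \in colors c by apply: mem_tnth.
by rewrite mem_undup => /codomP[f ->]; exists f.
Qed.

Lemma color_inj : injective (fun j : 'I_C => color j).
Proof. by apply/tuple_uniqP; apply: undup_uniq. Qed.

Definition velocities u : 'rV[R]_(#|V| * 2) :=
  mxvec (\matrix_(j < #|V|, k < 2) u (enum_val j) 0 k).

(** The component of s at a colour is the common rate of dilation
    P . (u_v - u_w) / |P|^2 that the kernel equations impose on the edges of
    that colour. *)
Definition motion u (s : 'rV[R]_C) : 'rV[R]_(#|V| * 2 + C) :=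
  row_mx (velocities u) s.

Lemma motionP x : exists u s, x = motion u s.
Proof.
exists (fun v => \row_k vec_mx (lsubmx x) (enum_rank v) k), (rsubmx x).
rewrite /motion /velocities -[LHS]hsubmxK; congr row_mx.
rewrite -[LHS]vec_mxK; congr mxvec.
by apply/matrixP => j k; rewrite !mxE enum_valK.
Qed.

Lemma motion_inj u u' s s' : motion u s = motion u' s' -> u =1 u' /\ s = s'.
Proof.
move=> /eq_row_mx[/(can_inj mxvecK) /matrixP uu' ->]; split=> // v.
by apply/rowP => k; have := uu' (enum_rank v) k; rewrite !mxE enum_rankK.
Qed.

Lemma eq_motion u u' s : u =1 u' -> motion u s = motion u' s.
Proof.
move=> uu'; congr (row_mx (mxvec _) _).
by apply/matrixP => j k; rewrite !mxE uu'.
Qed.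

Lemma mul_rigidity_mx u (i : 'I_#|{: edge G}|) (f := enum_val i) :
  (velocities u *m (rigidity_mx G p)^T) 0 i =
  dot (edge_vec p f) (u (endpoint f 0) - u (endpoint f 1)).
Proof.
rewrite mxE; under eq_bigr do rewrite [(_^T) _ _]mxE [rigidity_mx _ _ _ _]mxE.
rewrite sum_mxvec (reindex (@enum_rank V)) /=; last first.
  exact/onW_bij/enum_rank_bij.
have ne := negPf (endpoint_neq f); rewrite eq_sym in ne.
rewrite (bigD1 (endpoint f 0)) //= (bigD1 (endpoint f 1)) ?ne //=.
rewrite [X in _ + (_ + X)]big1 ?addr0 => [|v /andP[v0 v1]]; last first.
  apply: big1 => k _; rewrite !mxE enum_rankK.
  by rewrite (negPf v0) (negPf v1) mulr0.
rewrite /dot -big_split /=; apply: eq_bigr => k _.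
rewrite !mxE !enum_rankK !eqxx -/f ne.
by ring.
Qed.

Lemma mul_color_mx (s : 'rV[R]_C) (i : 'I_#|{: edge G}|) (f := enum_val i) j :
  c f = color j ->
  (s *m (color_mx c p)^T) 0 i = - (s 0 j * dot (edge_vec p f) (edge_vec p f)).
Proof.
move=> cfj; rewrite mxE (bigD1 j) //= !mxE -/f /= cfj eqxx mulrN.
rewrite big1 ?addr0 // => j' jj'; rewrite !mxE -/f /= cfj.
by rewrite (inj_eq color_inj) eq_sym (negPf jj') mulr0.
Qed.

(** Vectors are rows here, so the right kernel of the matrix is the row kernel
    of its transpose. *)
Lemma motion_kerP u (s : 'rV[R]_C) :
  reflect (forall f j, c f = color j ->
             dot (edge_vec p f) (u (endpoint f 0) - u (endpoint f 1)) =
             s 0 j * dot (edge_vec p f) (edge_vec p f))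
          (motion u s <= kermx (angle_rigidity_mx c p)^T)%MS.
Proof.
rewrite sub_kermx tr_row_mx mul_row_col.
apply: (iffP eqP) => [ker f j cfj | flex]; last first.
  apply/rowP => i; have [j cij] := edge_colorP (enum_val i).
  rewrite mxE mul_rigidity_mx (mul_color_mx _ cij) [RHS]mxE (flex _ _ cij).
  exact: subrr.
move/rowP/(_ (enum_rank f)): ker.
rewrite mxE mul_rigidity_mx (@mul_color_mx _ _ j) ?enum_rankK // [RHS]mxE.
by move/eqP; rewrite subr_eq0 => /eqP.
Qed.

(** * Edge rotations and flexes *)

Lemma edge_rotation_sym u v w : edge_rotation p u v w = edge_rotation p u w v.
Proof.
rewrite /edge_rotation /diffp -[p v - p w]opprB -[u v - u w]opprB.
by rewrite perpN dotNN scalerN dotNN.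
Qed.

Lemma edge_rotation_endpoints u f a b : val f = [set a; b] ->
  edge_rotation p u a b = edge_rotation p u (endpoint f 0) (endpoint f 1).
Proof.
move=> fab; have := edge_endpoints f; have := endpoint_neq f.
set v := endpoint f 0; set w := endpoint f 1 => vw fvw.
have : v \in val f by rewrite fvw set21.
have : w \in val f by rewrite fvw set22.
rewrite fab !inE => /orP[]/eqP wE /orP[]/eqP vE.
- by rewrite vE wE eqxx in vw.
- by rewrite vE wE edge_rotation_sym.
- by rewrite vE wE.
- by rewrite vE wE eqxx in vw.
Qed.

Hypothesis p_inj : injective p.

Lemma edge_norm_neq0 f : dot (edge_vec p f) (edge_vec p f) != 0.
Proof. by rewrite dot_eq0 subr_eq0 (inj_eq p_inj) endpoint_neq. Qed.

(** Rotating the velocities exchanges dilation and rotation: the dilation rate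
    of an edge under u is its rotation rate under the rotated velocities. *)
Lemma perp_edge_rotation u f :
  edge_rotation p (fun v => perp (u v)) (endpoint f 0) (endpoint f 1) =
  dot (edge_vec p f) (u (endpoint f 0) - u (endpoint f 1)) /
  dot (edge_vec p f) (edge_vec p f).
Proof. by rewrite /edge_rotation /= -perpB dotZl dot_perp mulrC. Qed.

(** The kernel equations say that the dilation rates of the edges of a colour
    all equal s at that colour; for the rotated velocities these are the rotation
    rates, which the flex condition makes constant on each colour. *)
Lemma perp_flexP u :
  infinitesimal_flex c p (fun v => perp (u v)) <->
  exists s, (motion u s <= kermx (angle_rigidity_mx c p)^T)%MS.
Proof.
split=> [flex | [s /motion_kerP ker] f g a b v w fab gvw cfg].
  (* F picks an edge of each colour; its rotation rate is the value of s. *)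
  have [F FE] := fin_all_exists color_edgeP.
  pose s : 'rV[R]_C := \row_j edge_rotation p (fun v => perp (u v))
                               (endpoint (F j) 0) (endpoint (F j) 1).
  exists s; apply/motion_kerP => f j cfj.
  have /eqP := flex _ _ _ _ _ _ (edge_endpoints f) (edge_endpoints (F j))
                 (etrans cfj (esym (FE j))).
  rewrite subr_eq0 => /eqP rot.
  by rewrite mxE -rot perp_edge_rotation divfK ?edge_norm_neq0.
have [j cfj] := edge_colorP f.
rewrite (edge_rotation_endpoints _ fab) (edge_rotation_endpoints _ gvw).
rewrite !perp_edge_rotation (ker _ _ cfj) (ker g j) -?cfg //.
by rewrite !mulfK ?edge_norm_neq0 ?subrr.
Qed.

(** * Infinitesimal similarities *)

(** The parameter t is the row (alpha, beta, z). All edges dilate at the rate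
    alpha under this motion, which is why it is the value at every colour. *)
Definition similarity (t : 'rV[R]_(2 + 2)) : 'rV[R]_(#|V| * 2 + C) :=
  motion (fun v => lsubmx t 0 0 *: p v + lsubmx t 0 1 *: perp (p v) + rsubmx t)
         (const_mx (lsubmx t 0 0)).

Lemma similarity_linear : linear similarity.
Proof.
move=> a t t'; rewrite /similarity /motion /velocities.
rewrite scale_row_mx add_row_mx; congr row_mx.
  rewrite -linearZ -linearD; congr mxvec; apply/matrixP => j k.
  by rewrite !mxE; ring.
by apply/rowP => j; rewrite !mxE.
Qed.

HB.instance Definition _ :=
  GRing.isLinear.Build R 'rV[R]_(2 + 2) 'rV[R]_(#|V| * 2 + C) _
    similarity similarity_linear.

Definition similarity_mx := lin1_mx similarity.

Lemma sub_similarityP x :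
  reflect (exists a b z, x = motion (fun v => a *: p v + b *: perp (p v) + z)
                                    (const_mx a))
          (x <= similarity_mx)%MS.
Proof.
apply: (iffP submxP) => [[t ->] | [a [b [z ->]]]].
  by rewrite mul_rV_lin1; do 3 eexists.
exists (row_mx (\row_k (if k == 0 then a else b)) z).
by rewrite mul_rV_lin1 /= /similarity row_mxKl row_mxKr !mxE.
Qed.

Lemma similarity_mx_ker :
  (similarity_mx <= kermx (angle_rigidity_mx c p)^T)%MS.
Proof.
apply/rV_subP => x /sub_similarityP[a [b [z ->]]].
apply/motion_kerP => f j _; rewrite mxE -(dot_similarity a b); congr dot.
by rewrite /edge_vec /diffp perpB; apply: row2P; rewrite !mxE /=; ring.
Qed.

(** The motion at two distinct vertices determines its parameters: the
    difference of velocities determines alpha and beta because the points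
    differ, and then one velocity determines z. *)
Lemma similarity_mx_free : (2 <= #|V|)%N -> row_free similarity_mx.
Proof.
move=> V2; apply/inj_row_free => t; rewrite mul_rV_lin1 /= => t0.
have : similarity t = motion (fun=> 0) 0.
  rewrite t0 /motion /velocities -row_mx0; congr row_mx.
  by apply/esym/eqP; rewrite mxvec_eq0; apply/eqP/matrixP => i j; rewrite !mxE.
move=> /motion_inj[vel0 _].
have [v [w [_ _ vw]]] : exists v w : V, [/\ v \in V, w \in V & v != w].
  by apply/card_gt1P.
have [||a0 b0] := similarity_eq0 (a := lsubmx t 0 0) (b := lsubmx t 0 1)
                                 (x := p v - p w).
- by rewrite subr_eq0 (inj_eq p_inj).
- rewrite perpB -[RHS]subr0 -{1}(vel0 v) -(vel0 w).
  by apply: row2P; rewrite !mxE /=; ring.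
have z0 := vel0 v; rewrite a0 b0 !scale0r !add0r in z0.
rewrite -[t]hsubmxK z0 -row_mx0; congr row_mx.
by apply: row2P; rewrite ?a0 ?b0 mxE.
Qed.

(** The rotation maps infinitesimal similarities to themselves, so a kernel
    vector is a similarity as soon as its rotated velocities are a trivial flex.
    Its colour part is then forced, since each colour occurs on an edge. *)
Lemma rigid_kerP :
  infinitesimally_angle_rigid c p <->
  (kermx (angle_rigidity_mx c p)^T <= similarity_mx)%MS.
Proof.
split=> [rigid | /rV_subP ker u flex].
  apply/rV_subP => x; have [u [s ->]] := motionP x => ker.
  have [|a [b [z triv]]] := rigid (fun v => perp (u v)).
    by apply/perp_flexP; exists s.
  have uE v : u v = b *: p v + (- a) *: perp (p v) + - perp z.
    rewrite -[u v]opprK -[- u v]perpK triv.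
    by rewrite perp_similarity; apply: row2P; rewrite !mxE /=; ring.
  apply/sub_similarityP; exists b, (- a), (- perp z).
  rewrite (eq_motion _ uE); congr motion; apply/rowP => j; rewrite mxE.
  have [f cfj] := color_edgeP j; move/motion_kerP/(_ f j cfj): ker.
  rewrite !uE => ker; apply: (mulIf (edge_norm_neq0 f)).
  rewrite -ker -(dot_similarity b (- a)); congr dot.
  by rewrite /edge_vec /diffp perpB; apply: row2P; rewrite !mxE /=; ring.
(* A flex is the rotation of its image under the inverse rotation. *)
pose u' v := - perp (u v).
have uE v : u v = perp (u' v) by rewrite /u' perpN perpK opprK.
have [|s /ker /sub_similarityP] := (perp_flexP u').1.
  move=> f g a b v w fab gvw cfg.
  rewrite /edge_rotation /= -!uE; exact: flex fab gvw cfg.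
move=> [a [b [z /motion_inj[u'E _]]]].
by exists (- b), a, (perp z) => v; rewrite uE u'E perp_similarity.
Qed.

(** By rank-nullity the difference is the dimension of the kernel; as the kernel
    contains the 4-dimensional space of similarities, it is equal to that space
    exactly when its dimension is 4. *)
Lemma angle_rigidE : (2 <= #|V|)%N ->
  infinitesimally_angle_rigid c p <->
  (#|V| * 2 + C - \rank (angle_rigidity_mx c p) = 4)%N.
Proof.
move=> V2; rewrite rigid_kerP.
have [_ rankE] := mxrank_leqif_sup similarity_mx_ker.
rewrite -rankE mxrank_ker mxrank_tr.
have /eqP -> := similarity_mx_free V2.
by rewrite eq_sym; split=> /eqP.
Qed.

End Framework.

Theorem theorem2p12 (R : realType) (V : finType) (G : sgraph V)
    (K : eqType) (c : edge G -> K) (p : V -> 'rV[R]_2)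
    (hp : realization p) (hV : (2 <= #|V|)%N) :
  infinitesimally_angle_rigid c p <->
  \rank (angle_rigidity_mx c p) = (2 * #|V| + size (colors c) - 4)%N.
Proof.
rewrite (angle_rigidE _ hp hV) [(2 * #|V|)%N]mulnC.
(* This bound keeps the truncated subtraction in the statement exact. *)
have n4 : (4 <= #|V| * 2 + size (colors c))%N.
  by apply: leq_trans (leq_addr _ _); rewrite (leq_mul2r 2 2).
have rn : (\rank (angle_rigidity_mx c p) <= #|V| * 2 + size (colors c))%N.
  exact: rank_leq_col.
by split=> e; [rewrite -e subKn | rewrite e subKn].
Qed.
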